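(* Let $q=2n+1$ be an odd prime power, let $\chi_q$ be a generator of the group of all multiplicative characters of $\mathbb{F}_q$, let $$R_q=\prod_{0<k<(q-1)/4}\left(J_q(\phi_q,\chi_q^k)+J_q(\phi_q,\chi_q^{-k})\right)$$ (product over integers $k$), and let $x_q=R_q/2^{\lfloor n/2\rfloor}\in\mathbb{Z}$. Let $A_q=\left[\phi_q(s_i+s_j)\right]_{1\le i,j\le (q-1)/2}$, where $s_1,\dots,s_{(q-1)/2}$ are exactly all the nonzero squares of $\mathbb{F}_q$. (i) Suppose $q\equiv 3\pmod 4$. Then $-\det A_q=x_q^2$. (ii) Suppose $q\equiv 1\pmod 4$. Then $2\cdot\det A_q=a_q(E)\cdot x_q^2$, where $a_q(E)=-\sum_{x\in\mathbb{F}_q}\phi_q(x^3+x)$. In particular, when $q=p\equiv 1\pmod 4$ is a prime, if we write $p=c_p^2+4d_p^2$ with $c_p,d_p\in\mathbb{Z}$ and $c_p\equiv 1\pmod 4$, then $$\frac{\det A_p}{c_p}=x_p^2.$$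
   Context: $\mathbb{F}_q$ is the finite field with $q$ elements. Multiplicative characters of $\mathbb{F}_q$ are homomorphisms $\psi:\mathbb{F}_q^\times\to\mathbb{C}^\times$, forming a cyclic group of order $q-1$, and every one of them (including the trivial one) is extended by $\psi(0)=0$. $\phi_q$ is the unique quadratic multiplicative character: $\phi_q(x)=1$ if $x$ is a nonzero square, $\phi_q(0)=0$, and $\phi_q(x)=-1$ otherwise. For multiplicative characters $\chi,\psi$, the Jacobi sum is $J_q(\chi,\psi)=\sum_{x\in\mathbb{F}_q}\chi(x)\psi(1-x)$. The number $R_q$ is independent of the choice of the generator $\chi_q$. $E$ denotes the elliptic curve $Y^2=X^3+X$ over $\mathbb{Q}$. For a real number $r$, $\lfloor r\rfloor$ is the largest integer $\le r$. An empty product equals $1$. $A_q$ is regarded as an integer matrix.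
   Formalization: The exponent in x_q = R_q/2^{⌊n/2⌋} is corrected to ⌊(n-1)/2⌋ (the same for q≡3 mod 4); as printed, q=5 gives R_5=1 and x_5=1/2, not an integer, and (ii) would read 2=2·(1/4). *)

(* Defs.v *)
From HB Require Import structures.
From mathcomp Require Import all_boot all_order all_algebra all_field.

Set Implicit Arguments.
Unset Strict Implicit.
Unset Printing Implicit Defensive.

Import Order.TTheory GRing.Theory Num.Theory.
Local Open Scope ring_scope.

(* Characters take values in roots of unity, so algC serves as the field of
   complex numbers. *)

Definition is_square (F : finFieldType) (x : F) : bool :=
  [exists y : F, x == y ^+ 2].

Definition quad_char (F : finFieldType) (x : F) : int :=
  if x == 0 then 0 else if is_square x then 1 else -1.

Definition quad_charC (F : finFieldType) (x : F) : algC :=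
  (quad_char x)%:~R.

(* A homomorphism from the nonzero elements of F to those of algC,
   extended by 0 at 0. *)
Definition mult_char (F : finFieldType) (chi : F -> algC) : Prop :=
  [/\ chi 0 = 0,
      forall x, x != 0 -> chi x != 0
    & forall x y, x != 0 -> y != 0 -> chi (x * y) = chi x * chi y].

(* The test on x makes the power k = 0 the trivial character with value 0
   at 0. *)
Definition mult_char_exp (F : finFieldType) (chi : F -> algC) (k : int) :
    F -> algC :=
  fun x => if x == 0 then 0 else chi x ^ k.

Definition mult_char_generator (F : finFieldType) (chi : F -> algC) : Prop :=
  mult_char chi /\
  forall psi : F -> algC, mult_char psi ->
    exists k : int, psi =1 mult_char_exp chi k.

Definition jacobi_sum (F : finFieldType) (chi psi : F -> algC) : algC :=
  \sum_(x : F) chi x * psi (1 - x).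

(* The range 0 < k < (q - 1) / 4, with q = #|F|, is written without
   division. *)
Definition R_ (F : finFieldType) (chi : F -> algC) : algC :=
  \prod_(k < #|F| | (0 < k)%N && (4 * k < #|F| - 1)%N)
    (jacobi_sum (@quad_charC F) (mult_char_exp chi k%:Z)
     + jacobi_sum (@quad_charC F) (mult_char_exp chi (- k%:Z))).

(* Here n = (q - 1) / 2. The exponent floor ((n - 1) / 2) is the number of
   factors of R_; it equals floor (n / 2) when n is odd, that is, when
   q = 3 mod 4. For q = 1 mod 4 the exponent floor (n / 2) would exceed it by
   one: already for q = 5 it gives 1 / 2, which is not an integer. *)
Definition x_ (F : finFieldType) (n : nat) (chi : F -> algC) : algC :=
  R_ chi / 2%:R ^+ ((n - 1) %/ 2)%N.

Definition enumerates_nonzero_squares (F : finFieldType) (n : nat)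
    (s : 'I_n -> F) : Prop :=
  injective s /\
  forall x : F, (exists i, s i = x) <-> (x != 0) && is_square x.

Definition A_ (F : finFieldType) (n : nat) (s : 'I_n -> F) : 'M[int]_n :=
  \matrix_(i < n, j < n) quad_char (s i + s j).

(* a_q of the elliptic curve Y^2 = X^3 + X. *)
Definition a_E (F : finFieldType) : int :=
  - \sum_(x : F) quad_char (x ^+ 3 + x).

(* Main.v *)
(* Write the nonzero squares as g^(2a), a < n, for a generator g of F^*. Up to a
   permutation A_q is then the circulant matrix of f(a) = phi(1 + g^(2a)), so
   det A_q is the product over k mod n of the eigenvalues
   lambda_k = sum_a z^(ka) f(a), with z = chi(g)^2. Since f is even,
   lambda_(n-k) = lambda_k; moreover lambda_0 = -1, lambda_(n/2) = - a_q(E) / 2,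
   and J(phi, chi^k) + J(phi, chi^-k) = 2 (-1)^k lambda_k, so that x_q is, up to
   sign, the product of the lambda_k with 0 < k < n/2. That product is an integer
   because it is the determinant of convolution by f on the odd sequences, an
   integer matrix in the obvious basis.
   For (ii) with q = p prime, u = a_p(E) / 2 is 1 mod 4 by pairing a with n - a,
   and a second moment of the Jacobsthal sums sum_x phi(x) phi(x^2 + r) over r
   gives u^2 + v^2 = p; uniqueness of the representation as a sum of two squares
   yields u = c_p. *)
Require Import Defs.
From HB Require Import structures.
From mathcomp Require Import all_boot all_order all_algebra all_field.
From mathcomp Require Import perm cyclic zify ring.

Import Order.TTheory GRing.Theory Num.Theory.
Local Open Scope ring_scope.

Set Implicit Arguments.
Unset Strict Implicit.

(** * Periodic sums, palindromic products and sums of roots of unity *)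

Lemma sum_periodic_shift (V : zmodType) (n : nat) (h : nat -> V) (c : nat) :
  (forall a, h (a + n)%N = h a) ->
  \sum_(0 <= a < n) h (a + c)%N = \sum_(0 <= a < n) h a.
Proof.
move=> h_per; elim: c => [|c IHc]; first by apply: eq_bigr => a _; rewrite addn0.
rewrite -IHc; case: n h_per {IHc} => [|n] h_per; first by rewrite !big_nil.
rewrite big_nat_recr // big_nat_recl //= addrC; congr (_ + _).
  by rewrite -[in RHS](h_per (0 + c)%N); congr h; lia.
by apply: eq_bigr => a _; congr h; lia.
Qed.

Lemma sum_periodic_opp (V : zmodType) (n : nat) (h : nat -> V) :
  (forall a, h (a + n)%N = h a) ->
  \sum_(0 <= a < n) h (n - a)%N = \sum_(0 <= a < n) h a.
Proof.
move=> h_per; rewrite -(sum_periodic_shift 1 h_per) big_nat_rev /=.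
by rewrite !big_nat; apply: eq_bigr => a ?; congr h; lia.
Qed.

(** The indices a and n - a pair off, and a = n / 2 stays alone when n is even. The branch for n = 0
    keeps out a spurious term [h 0]. *)
Lemma big_palindrome (R : Type) (idx : R) (op : Monoid.com_law idx) (n : nat)
    (h : nat -> R) :
    (forall a, (0 < a < n)%N -> h (n - a)%N = h a) ->
  let P := \big[op/idx]_(1 <= a < ((n - 1) %/ 2).+1) h a in
  \big[op/idx]_(1 <= a < n) h a
    = op (op P P) (if odd n then idx else if n is 0 then idx else h (n %/ 2)%N).
Proof.
case: n => [|n] h_sym P; first by rewrite /P !big_geq //= !Monoid.mulm1.
have split_le : (1 <= ((n.+1 - 1) %/ 2).+1 <= n.+1)%N by lia.
rewrite (@big_cat_nat _ _ _ ((n.+1 - 1) %/ 2).+1) ?(andP split_le).1 ?(andP split_le).2 //.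
rewrite -/P -Monoid.mulmA; congr (op _ _).
have -> : P = \big[op/idx]_(n.+1 - (n.+1 - 1) %/ 2 <= a < n.+1) h a.
  have -> : (n.+1 - (n.+1 - 1) %/ 2 = 1 + (n - (n.+1 - 1) %/ 2))%N by lia.
  rewrite big_addn big_nat_rev /P.
  have -> : (n.+1 - (n - (n.+1 - 1) %/ 2) = ((n.+1 - 1) %/ 2).+1)%N by lia.
  rewrite !big_nat; apply: eq_bigr => a a_lt; rewrite -h_sym; last lia.
  by congr h; lia.
case: ifP => [n_odd | n_even].
  have -> : (((n.+1 - 1) %/ 2).+1 = n.+1 - (n.+1 - 1) %/ 2)%N by lia.
  exact/esym/Monoid.mulm1.
rewrite big_ltn; last by lia.
rewrite [RHS]Monoid.mulmC; congr (op _ _).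
  by congr h; lia.
by have -> : (((n.+1 - 1) %/ 2).+2 = n.+1 - (n.+1 - 1) %/ 2)%N by lia.
Qed.

Lemma sum_odd_even (V : nmodType) (n : nat) (h : nat -> V) :
  \sum_(0 <= j < 2 * n) h j
    = \sum_(0 <= a < n) h (2 * a)%N + \sum_(0 <= a < n) h (2 * a).+1.
Proof.
elim: n => [|n IHn]; first by rewrite !big_nil addr0.
by rewrite mulnS !big_nat_recr //= IHn -!addrA; congr (_ + _); rewrite addrCA.
Qed.

Lemma sum_prim_root (R : idomainType) (n : nat) (z : R) (j : nat) :
  n.-primitive_root z ->
  \sum_(0 <= a < n) z ^+ (j * a) = if (n %| j)%N then n%:R else 0.
Proof.
move=> z_prim; case: ifP => [n_dvd | n_ndvd].
  rewrite (eq_bigr (fun=> 1)) ?sumr_const_nat ?subn0 // => a _.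
  by rewrite exprM (eqP (_ : z ^+ j == 1)) ?expr1n // -(prim_order_dvd z_prim).
have zj_neq1 : z ^+ j - 1 != 0.
  by rewrite subr_eq0 -(prim_order_dvd z_prim) n_ndvd.
apply: (mulfI zj_neq1); rewrite mulr0.
under eq_bigr do rewrite exprM.
by rewrite big_mkord -subrX1 -exprM mulnC exprM (prim_expr_order z_prim) expr1n subrr.
Qed.

Lemma prim_root_half (R : idomainType) (n : nat) (z : R) :
  (0 < n)%N -> (2 * n).-primitive_root z -> z ^+ n = -1.
Proof.
move=> n_gt0 z_prim.
have /eqP : (z ^+ n) ^+ 2 = 1 by rewrite -exprM mulnC (prim_expr_order z_prim).
rewrite sqrf_eq1 => /orP[|/eqP//].
by rewrite -(prim_order_dvd z_prim) => /dvdn_leq; lia.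
Qed.

(** * Fourier diagonalisation of circulant matrices of even sequences *)

Section Circulant.

Variables (n : nat) (z : algC) (f : nat -> int).
Hypotheses (n_gt0 : (0 < n)%N) (z_prim : n.-primitive_root z).
Hypothesis f_per : forall a, f (a + n)%N = f a.
Hypothesis f_even : forall a, (a <= n)%N -> f (n - a)%N = f a.

Definition circ_eigen (k : nat) : algC :=
  \sum_(0 <= c < n) z ^+ (k * c) * (f c)%:~R.

Lemma prim_expr_mul (a k : nat) : z ^+ (a + k * n) = z ^+ a.
Proof. by rewrite exprD mulnC exprM (prim_expr_order z_prim) expr1n mulr1. Qed.

(** [f_even] covers indices up to n only; periodicity brings larger ones into that range. *)
Lemma even_periodic_opp (c a b : nat) : (a + b = c * n)%N -> f a = f b.
Proof.
elim: c a b => [|c IHc] a b ab; first by congr f; lia.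
have [a_ge | a_lt] := leqP n a.
  by rewrite -(subnK a_ge) f_per; apply: IHc; lia.
have [b_ge | b_lt] := leqP n b.
  by rewrite -(subnK b_ge) f_per; apply: IHc; lia.
have c0 : c = 0%N by nia.
rewrite -f_even; last exact: ltnW.
by congr f; move: ab; rewrite c0; lia.
Qed.

(** Characters of Z/n are eigenvectors of convolution. Indices being natural numbers, [n - b] stands
    for the residue -b. *)
Lemma circ_eigen_conv (k b : nat) : (b <= n)%N ->
  \sum_(0 <= a < n) z ^+ (k * a) * (f (a + (n - b))%N)%:~R
    = z ^+ (k * b) * circ_eigen k.
Proof.
move=> b_le.
pose h a := z ^+ (k * b) * (z ^+ (k * a) * (f a)%:~R).
rewrite /circ_eigen big_distrr /= -(@sum_periodic_shift _ n h (n - b)); last first.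
  by move=> a; rewrite /h f_per mulnDr prim_expr_mul.
apply: eq_bigr => a _; rewrite /h mulrA -exprD; congr (_ * _).
by rewrite -(prim_expr_mul (k * a) k); congr (_ ^+ _); nia.
Qed.

Lemma circ_eigen_sym (k : nat) : (k <= n)%N -> circ_eigen (n - k) = circ_eigen k.
Proof.
move=> k_le; rewrite /circ_eigen.
pose h a := z ^+ (k * a) * (f a)%:~R.
rewrite -(@sum_periodic_opp _ n h); last first.
  by move=> a; rewrite /h f_per mulnDr prim_expr_mul.
rewrite !big_nat; apply: eq_bigr => a /andP[_ a_lt]; rewrite /h f_even; last lia.
congr (_ * _); rewrite -(prim_expr_mul _ k) -[RHS](prim_expr_mul _ a).
congr (_ ^+ _); nia.
Qed.

Lemma circ_eigen_conv_sym (k b : nat) : (b <= n)%N ->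
  \sum_(0 <= a < n) z ^+ (k * a) * (f (a + b)%N)%:~R
    = z ^+ (k * (n - b)) * circ_eigen k.
Proof.
by move=> b_le; rewrite -circ_eigen_conv ?leq_subr // subKn.
Qed.

(** The rows of the Fourier matrix [V] are left eigenvectors of the circulant, and [W] is n times
    the inverse of [V], so [\det V] cancels. *)
Lemma det_circulant :
  (\det (\matrix_(a < n, b < n) f (a + (n - b))%N))%:~R
    = \prod_(0 <= k < n) circ_eigen k.
Proof.
pose V : 'M[algC]_n := \matrix_(k < n, a < n) z ^+ (k * a).
pose W : 'M[algC]_n := \matrix_(a < n, k < n) z ^+ (a * (n - k)).
set M := \matrix_(a < n, b < n) _.
have VW : V *m W = n%:R%:M.
  apply/matrixP => k l; rewrite !mxE.
  transitivity (\sum_(0 <= a < n) z ^+ ((k + (n - l)) * a)).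
    rewrite big_mkord; apply: eq_bigr => a _; rewrite !mxE -exprD; congr (_ ^+ _).
    by rewrite mulnDl [X in (_ + X)%N]mulnC.
  rewrite (sum_prim_root _ z_prim).
  have -> : (n %| k + (n - l))%N = (k == l).
    have := ltn_ord k; have := ltn_ord l => l_lt k_lt.
    apply/idP/eqP => [/dvdnP[c c_eq] | ->]; last by rewrite subnKC // ltnW.
    (* The sum k + (n - l) lies strictly between 0 and 2n. *)
    apply: val_inj => /=; have : c = 1%N by nia.
    by move=> c1; move: c_eq; rewrite c1; lia.
  by case: eqP; rewrite ?mulr1n ?mulr0n.
have VM : V *m map_mx intr M = diag_mx (\row_k circ_eigen k) *m V.
  apply/matrixP => k b; rewrite !mxE [RHS](bigD1 k) //= [X in _ + X]big1 ?addr0; last first.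
    by move=> l l_neq; rewrite !mxE eq_sym (negPf l_neq) mul0r.
  rewrite !mxE eqxx mulr1n mulrC -circ_eigen_conv; last by rewrite ltnW.
  by rewrite big_mkord; apply: eq_bigr => a _; rewrite !mxE.
have V_neq0 : \det V != 0.
  apply/eqP => detV0; have := congr1 determinant VW.
  rewrite det_mulmx detV0 mul0r det_scalar => /esym/eqP.
  by rewrite expf_eq0 pnatr_eq0 -[n == 0%N]negbK -lt0n n_gt0 andbF.
rewrite -det_map_mx; apply: (mulfI V_neq0).
rewrite -det_mulmx VM det_mulmx mulrC det_diag big_mkord; congr (_ * _).
by apply: eq_bigr => k _; rewrite !mxE.
Qed.

(* The sequences vanishing at 0 and n / 2 and odd under [a |-> n - a] are
   preserved by convolution with the even [f]; on them each eigenvalue with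
   [0 < k < n / 2] occurs exactly once. *)
Lemma det_circulant_odd :
  let m := ((n - 1) %/ 2)%N in
  (\det (\matrix_(a < m, b < m) (f (a.+1 + (n - b.+1)) - f (a.+1 + b.+1))))%:~R
    = \prod_(1 <= k < m.+1) circ_eigen k.
Proof.
move=> m.
(* Up to a constant factor these are discrete sines; those with 0 < k < n / 2 form a basis of the
   odd sequences. *)
pose u k a : algC := z ^+ (k * a) - z ^+ (k * (n - a)).
have u_opp k a : (a <= n)%N -> u k (n - a)%N = - u k a.
  by move=> a_le; rewrite /u subKn // opprB.
have zk_opp k a : (k <= n)%N -> (a <= n)%N -> z ^+ (k * (n - a)) = z ^+ ((n - k) * a).
  move=> k_le a_le; rewrite -(prim_expr_mul _ a) -[RHS](prim_expr_mul _ k).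
  congr (_ ^+ _); nia.
(* Orthogonality of characters needs a full period, while the matrices only sum over 0 < a < n / 2;
   this passes from one range to the other. *)
have fold (h : nat -> algC) : h 0%N = 0 ->
    (forall a, (a <= n)%N -> h (n - a)%N = h a) ->
    ((forall a, (2 * a)%N = n -> h a = 0)) ->
    \sum_(0 <= a < n) h a = 2%:R * \sum_(1 <= a < m.+1) h a.
  move=> h0 h_sym h_mid; rewrite big_ltn // h0 add0r big_palindrome; last first.
    by move=> a a_lt; apply: h_sym; lia.
  rewrite -/m /= mulr_natl; set X := (X in _ + _ + X).
  suff -> : X = 0 by rewrite addr0.
  rewrite /X; case: ifP => // n_even.
  by case: n n_gt0 n_even h_mid => // n' _ n_even -> //; lia.
have u_mid k a : (2 * a)%N = n -> u k a = 0.
  move=> a_mid; rewrite /u; have -> : (n - a = a)%N by lia.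
  by rewrite subrr.
have u0 k : u k 0%N = 0.
  by rewrite /u muln0 subn0 -[(k * n)%N]add0n prim_expr_mul subrr.
pose U : 'M[algC]_m := \matrix_(k < m, a < m) u k.+1 a.+1.
set C := \matrix_(a < m, b < m) _.
have two_neq0 : 2%:R != 0 :> algC by rewrite pnatr_eq0.
have UC : U *m map_mx intr C = diag_mx (\row_k circ_eigen k.+1) *m U.
  apply/matrixP => k b; rewrite !mxE [RHS](bigD1 k) //= [X in _ + X]big1 ?addr0; last first.
    by move=> l l_neq; rewrite !mxE eq_sym (negPf l_neq) mul0r.
  rewrite !mxE eqxx mulr1n.
  have k_lt := ltn_ord k; have b_lt := ltn_ord b.
  apply: (mulfI two_neq0).
  pose h a := u k.+1 a * (f (a + (n - b.+1)) - f (a + b.+1))%:~R.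
  transitivity (2%:R * \sum_(1 <= a < m.+1) h a).
    congr (_ * _); rewrite big_add1 /= big_mkord.
    by apply: eq_bigr => a _; rewrite !mxE.
  rewrite -fold; first last.
  - by move=> a a_mid; rewrite /h u_mid // mul0r.
  - move=> a a_le; rewrite /h u_opp // mulNr -mulrN -rmorphN opprB; congr (_ * (_ - _)%:~R).
      by apply: (@even_periodic_opp 2); lia.
    by apply: (@even_periodic_opp 2); lia.
  - by rewrite /h u0 mul0r.
  (* The product of two differences expands into four sums, instances of [circ_eigen_conv] and of
     its mirror image [circ_eigen_conv_sym]. *)
  transitivity (z ^+ (k.+1 * b.+1) * circ_eigen k.+1
      - z ^+ (k.+1 * (n - b.+1)) * circ_eigen k.+1
      - z ^+ ((n - k.+1) * b.+1) * circ_eigen (n - k.+1)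
      + z ^+ ((n - k.+1) * (n - b.+1)) * circ_eigen (n - k.+1)).
    rewrite -!circ_eigen_conv_sym -?circ_eigen_conv; try by lia.
    rewrite -!sumrB -big_split /= !big_nat; apply: eq_bigr => a /andP[_ a_lt].
    by rewrite /h /u zk_opp ?rmorphB; [ring | lia | lia].
  rewrite circ_eigen_sym; last by lia.
  by rewrite -!zk_opp ?subKn /u; [ring | lia ..].
(* Orthogonality of sines: of the four character sums only the two of frequency k - l and l - k can
   be nonzero, and for k = l they total -2n. *)
have UUT : U *m U^T = (- n%:R)%:M.
  apply/matrixP => k l; rewrite !mxE; have k_lt := ltn_ord k; have l_lt := ltn_ord l.
  apply: (mulfI two_neq0).
  pose h a := u k.+1 a * u l.+1 a.
  transitivity (2%:R * \sum_(1 <= a < m.+1) h a).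
    congr (_ * _); rewrite big_add1 /= big_mkord.
    by apply: eq_bigr => a _; rewrite !mxE.
  rewrite -fold; first last.
  - by move=> a a_mid; rewrite /h u_mid // mul0r.
  - by move=> a a_le; rewrite /h !u_opp // mulrNN.
  - by rewrite /h u0 mul0r.
  transitivity (\sum_(0 <= a < n) z ^+ ((k.+1 + l.+1) * a)
      - \sum_(0 <= a < n) z ^+ ((k.+1 + (n - l.+1)) * a)
      - \sum_(0 <= a < n) z ^+ (((n - k.+1) + l.+1) * a)
      + \sum_(0 <= a < n) z ^+ (((n - k.+1) + (n - l.+1)) * a)).
    rewrite -!sumrB -big_split /= !big_nat; apply: eq_bigr => a /andP[_ a_lt].
    rewrite /h /u !zk_opp; try by lia.
    by move: (k.+1) (l.+1) => k1 l1; rewrite !mulnDl !exprD; ring.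
  rewrite !(sum_prim_root _ z_prim).
  have ndvd j : (0 < j < n)%N -> (n %| j)%N = false.
    by case/andP=> ? ?; apply/negP => /dvdn_leq; lia.
  have -> : (n %| k.+1 + l.+1)%N = false by apply: ndvd; lia.
  have -> : (n %| (n - k.+1) + (n - l.+1))%N = false.
    have -> : ((n - k.+1) + (n - l.+1) = n + (n - (k.+1 + l.+1)))%N by lia.
    by rewrite dvdn_addr // ndvd //; lia.
  have [-> | k_neq] := eqVneq k l.
    by rewrite subnKC ?subnK ?dvdnn; [rewrite mulr1n; ring | lia ..].
  have {}k_neq : k != l :> nat by [].
  have -> : (n %| k.+1 + (n - l.+1))%N = false.
    apply/negP => /dvdnP[c c_eq]; have : c = 1%N by nia.
    by move=> c1; move: c_eq; rewrite c1; lia.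
  have -> : (n %| (n - k.+1) + l.+1)%N = false.
    apply/negP => /dvdnP[c c_eq]; have : c = 1%N by nia.
    by move=> c1; move: c_eq; rewrite c1; lia.
  by rewrite mulr0n mulr0 !subr0 addr0.
have U_neq0 : \det U != 0.
  apply/eqP => detU0; have := congr1 determinant UUT.
  rewrite det_mulmx detU0 mul0r det_scalar => /esym/eqP.
  by rewrite expf_eq0 oppr_eq0 pnatr_eq0 -[n == 0%N]negbK -lt0n n_gt0 andbF.
rewrite -det_map_mx; apply: (mulfI U_neq0).
rewrite -det_mulmx UC det_mulmx mulrC det_diag big_add1 big_mkord; congr (_ * _).
by apply: eq_bigr => k _; rewrite !mxE.
Qed.

End Circulant.

(** * A generator of the multiplicative group and the quadratic character *)

Lemma finField_prim_root (F : finFieldType) :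
  exists g : F, (#|F|.-1).-primitive_root g.
Proof.
pose rs := enum (predC1 (0 : F)).
have rs_size : size rs = #|F|.-1 by rewrite -cardE cardC1.
have F_gt1 : (1 < #|F|)%N := finNzRing_gt1 F.
have rs_roots : all (#|F|.-1).-unity_root rs.
  apply/allP => x; rewrite mem_enum unity_rootE => /= x_neq0.
  by apply/eqP/(mulfI x_neq0); rewrite mulr1 -exprS prednK ?expf_card // ltnW.
have N_gt0 : (0 < #|F|.-1)%N by rewrite -ltnS prednK // ltnW.
have rs_ge : (#|F|.-1 <= size rs)%N by rewrite rs_size.
by have /hasP[g _ g_prim] := has_prim_root N_gt0 rs_roots (enum_uniq _) rs_ge; exists g.
Qed.

Section QuadraticCharacter.

Variables (F : finFieldType) (n : nat) (g : F).
Hypotheses (n_gt0 : (0 < n)%N) (cardF : #|F| = (2 * n + 1)%N).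
Hypothesis g_prim : (2 * n).-primitive_root g.

Lemma gen_neq0 (j : nat) : g ^+ j != 0.
Proof.
apply/expf_neq0/negP => /eqP g0; have := prim_expr_order g_prim.
by move/eqP; rewrite g0 expr0n; case: n n_gt0 => //= k; rewrite eq_sym oner_eq0.
Qed.

Lemma gen_expr (x : F) : x != 0 -> exists2 j, (j < 2 * n)%N & x = g ^+ j.
Proof.
move=> x_neq0; have [|j ->] := prim_rootP g_prim (x := x); last by exists j.
apply: (mulfI x_neq0); rewrite mulr1 -exprS -(addn1 (2 * n)) -cardF; exact: expf_card.
Qed.

Lemma sum_gen (V : nmodType) (h : F -> V) :
  \sum_(x | x != 0) h x = \sum_(0 <= j < 2 * n) h (g ^+ j).
Proof.
rewrite -[RHS](@big_map _ _ _ _ _ (fun j => g ^+ j) _ xpredT h) -[LHS]big_filter.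
apply: perm_big; apply: uniq_perm.
- by rewrite filter_uniq // /index_enum -enumT enum_uniq.
- rewrite map_inj_in_uniq ?iota_uniq // => i j; rewrite !mem_index_iota => i_lt j_lt /eqP.
  by rewrite (eq_prim_root_expr g_prim) => /eqP; rewrite !modn_small.
- move=> x; rewrite mem_filter mem_index_enum andbT; apply/idP/mapP => [x_neq0 | [j _ ->]].
    by have [j j_lt ->] := gen_expr x_neq0; exists j; rewrite ?mem_index_iota.
  exact: gen_neq0.
Qed.

Lemma gen_half : g ^+ n = -1.
Proof. exact: prim_root_half n_gt0 g_prim. Qed.

Lemma gen_double : g ^+ (2 * n) = 1.
Proof. exact: prim_expr_order. Qed.

(** The parity of an exponent is well defined because the order 2n of g is even. *)
Lemma is_square_gen (j : nat) : is_square (g ^+ j) = ~~ odd j.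
Proof.
apply/existsP/idP => [[y /eqP yE] | j_even]; last first.
  by exists (g ^+ j./2); rewrite -exprM muln2 halfK (negPf j_even) subn0.
have y_neq0 : y != 0.
  by apply/eqP => y0; have := gen_neq0 j; rewrite yE y0 expr0n eqxx.
have [i _ y_gen] := gen_expr y_neq0.
move/eqP: yE; rewrite y_gen -exprM (eq_prim_root_expr g_prim) => /eqP.
move/(congr1 (fun k => k %% 2)%N); rewrite !modn_dvdm ?dvdn_mulr //.
by rewrite !modn2 oddM andbF => /eqP; rewrite eqb0.
Qed.

Lemma quad_char0 : quad_char (0 : F) = 0.
Proof. by rewrite /quad_char eqxx. Qed.

Lemma quad_char_gen (j : nat) : quad_char (g ^+ j) = (-1) ^+ j.
Proof.
rewrite /quad_char (negPf (gen_neq0 j)) is_square_gen -signr_odd.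
by case: (odd j).
Qed.

Lemma quad_char_gen_double (j : nat) : quad_char (g ^+ (2 * j)) = 1.
Proof. by rewrite quad_char_gen exprM sqrrN !expr1n. Qed.

Lemma quad_charM (x y : F) : quad_char (x * y) = quad_char x * quad_char y.
Proof.
have [->|/gen_expr[i _ ->]] := eqVneq x 0; first by rewrite mul0r quad_char0 mul0r.
have [->|/gen_expr[j _ ->]] := eqVneq y 0; first by rewrite mulr0 quad_char0 mulr0.
by rewrite -exprD !quad_char_gen exprD.
Qed.

Lemma quad_charMself (x : F) : x != 0 -> quad_char x * quad_char x = 1.
Proof. by case/gen_expr=> j _ ->; rewrite quad_char_gen -expr2 sqrr_sign. Qed.

Lemma quad_char1 : quad_char (1 : F) = 1.
Proof. by rewrite -(expr0 g) quad_char_gen. Qed.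

Lemma sum_quad_char : \sum_(x : F) quad_char x = 0.
Proof.
rewrite (bigD1 0) //= quad_char0 add0r sum_gen sum_odd_even -big_split big1 //= => a _.
by rewrite !quad_char_gen exprS mulN1r subrr.
Qed.

(** Since x(x + d) = x^2 (1 + d/x), substituting t = d/x leaves the sum of phi(1 + t) over nonzero
    t, which is -phi(1). *)
Lemma sum_quad_char_shift (d : F) : d != 0 ->
  \sum_x quad_char x * quad_char (x + d) = -1.
Proof.
move=> d_neq0; rewrite (bigD1 0) //= quad_char0 mul0r add0r.
rewrite (eq_bigr (fun x => quad_char (1 + d / x))); last first.
  move=> x x_neq0; have -> : x + d = x * (1 + d / x) by field.
  by rewrite quad_charM mulrA quad_charMself // mul1r.
(* As the inverse of 0 is 0, this map is an involution of the whole field, 0 included. *)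
rewrite (reindex (fun t => d / t)) /=; last first.
  exists (fun t => d / t) => t _; have [->|t_neq0] := eqVneq t 0;
    rewrite ?invr0 ?mulr0 ?invr0 ?mulr0 //; field; exact/andP.
rewrite (eq_big (fun t => t != 0) (fun t => quad_char (1 + t))); first last.
- move=> t; rewrite mulf_eq0 invr_eq0 negb_or d_neq0 => t_neq0.
  by congr (quad_char (_ + _)); field; apply/andP.
- by move=> t; rewrite mulf_eq0 invr_eq0 negb_or d_neq0.
have := sum_quad_char; rewrite (reindex (fun t => 1 + t)) /=; last first.
  by exists (fun t => t - 1) => t _; ring.
by rewrite (bigD1 0) //= addr0 quad_char1 => /eqP; rewrite addrC addr_eq0 => /eqP.
Qed.

(** * Characters, Jacobi sums and the reduction of [A_] to a circulant matrix *)

Definition quad_circ (a : nat) : int := quad_char (1 + g ^+ (2 * a)).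

(** Raises w to the discrete logarithm of x; the resulting character of order 2n serves as a test in
    [generator_prim_root]. *)
Lemma mult_char_prim_root (w : algC) : (2 * n).-primitive_root w ->
  exists2 psi : F -> algC, mult_char psi & psi g = w.
Proof.
move=> w_prim.
pose logg (x : F) := index x [seq g ^+ j | j <- iota 0 (2 * n)].
have loggK x : x != 0 -> g ^+ logg x = x.
  move=> /gen_expr[j j_lt xE].
  have x_in : x \in [seq g ^+ j | j <- iota 0 (2 * n)].
    by rewrite xE; apply: map_f; rewrite mem_iota.
  have lt : (logg x < 2 * n)%N by move: x_in; rewrite -index_mem size_map size_iota.
  have := nth_index 0 x_in; rewrite -/(logg x) (nth_map 0%N) ?size_iota //.
  by rewrite nth_iota.
have w_neq0 : w != 0.
  apply/eqP => w0; have := prim_expr_order w_prim.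
  by move/eqP; rewrite w0 expr0n; case: n n_gt0 => //= k; rewrite eq_sym oner_eq0.
have g_neq0 : g != 0 := gen_neq0 1.
have w_eq i j : g ^+ i = g ^+ j -> w ^+ i = w ^+ j.
  by move/eqP; rewrite (eq_prim_root_expr g_prim) -(eq_prim_root_expr w_prim) => /eqP.
exists (fun x => if x == 0 then 0 else w ^+ logg x); last first.
  by rewrite (negPf g_neq0) -[RHS]expr1; apply: w_eq; rewrite loggK.
split=> [|x x_neq0|x y x_neq0 y_neq0]; first by rewrite eqxx.
  by rewrite (negPf x_neq0) expf_neq0.
rewrite mulf_eq0 (negPf x_neq0) (negPf y_neq0) -exprD; apply: w_eq.
by rewrite exprD !loggK // mulf_neq0.
Qed.

Variable chi : F -> algC.

Lemma mult_char1 : mult_char chi -> chi 1 = 1.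
Proof.
case=> _ chi_neq0 chiM; apply: (mulfI (chi_neq0 1 (oner_neq0 _))).
by rewrite -chiM ?oner_neq0 // !mulr1.
Qed.

Lemma mult_charX (j : nat) : mult_char chi -> chi (g ^+ j) = chi g ^+ j.
Proof.
move=> chi_mult; have [_ _ chiM] := chi_mult.
elim: j => [|j IHj]; first by rewrite !expr0 mult_char1.
by rewrite !exprS chiM ?IHj ?gen_neq0 //; apply: (gen_neq0 1).
Qed.

(** Some character sends g to a root of unity of exact order 2n. Being a power of [chi], it forces
    the order of [chi g] to be a multiple of 2n. *)
Lemma generator_prim_root : mult_char_generator chi -> (2 * n).-primitive_root (chi g).
Proof.
case=> chi_mult chi_gen.
have N_gt0 : (0 < 2 * n)%N by lia.
have [w w_prim] := C_prim_root_exists N_gt0.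
have [psi psi_mult psi_g] := mult_char_prim_root w_prim.
have [k psiE] := chi_gen _ psi_mult.
have wE : w = chi g ^ k.
  by rewrite -psi_g psiE /mult_char_exp (negPf (gen_neq0 1)).
have chi_order : chi g ^+ (2 * n) = 1.
  by rewrite -mult_charX // (prim_expr_order g_prim) mult_char1.
have [d d_prim d_dvd] := prim_order_exists N_gt0 chi_order.
suff -> : (2 * n = d)%N by [].
apply/eqP; rewrite eqn_dvd d_dvd andbT (prim_order_dvd w_prim) wE.
by rewrite exprnP exprz_exp mulrC -exprz_exp -exprnP (prim_expr_order d_prim) exp1rz.
Qed.

Hypothesis chi_gen : mult_char_generator chi.

(** Exchanging x and 1 - x puts [chi] on the powers of g; the term at 0 vanishes by the convention
    on characters. *)
Lemma jacobi_sum_gen (e : int) :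
  jacobi_sum (@quad_charC F) (mult_char_exp chi e)
    = \sum_(0 <= j < 2 * n) (quad_char (1 - g ^+ j))%:~R * (chi g ^ e) ^+ j.
Proof.
have [chi_mult _] := chi_gen.
rewrite /jacobi_sum (reindex (fun x => 1 - x)) /=; last first.
  by exists (fun x => 1 - x) => x _; rewrite opprB addrCA subrr addr0.
rewrite /mult_char_exp (bigD1 0) //= subr0 subrr eqxx mulr0 add0r.
rewrite sum_gen; apply: eq_bigr => j _; congr (_ * _).
rewrite opprB addrCA subrr addr0 (negPf (gen_neq0 j)).
by rewrite mult_charX // !exprnP !exprz_exp mulrC.
Qed.

Lemma quad_circ_per (a : nat) : quad_circ (a + n) = quad_circ a.
Proof. by rewrite /quad_circ mulnDr exprD gen_double mulr1. Qed.

(** 1 + g^(-2a) is the square g^(-2a) times 1 + g^(2a). *)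
Lemma quad_circ_even (a : nat) : (a <= n)%N -> quad_circ (n - a) = quad_circ a.
Proof.
move=> a_le; rewrite -[LHS]mul1r /quad_circ.
rewrite -(quad_char_gen_double a).
rewrite -quad_charM mulrDr mulr1 -exprD.
by rewrite -mulnDr subnKC // gen_double addrC.
Qed.

(** Since phi(1 + g^(-j)) = (-1)^j phi(1 + g^j), reversing j turns the second sum into the first
    with weights (-1)^j, so odd j cancel and even j count twice. *)
Lemma jacobi_sum_circ (k : nat) :
  jacobi_sum (@quad_charC F) (mult_char_exp chi k%:Z)
    + jacobi_sum (@quad_charC F) (mult_char_exp chi (- k%:Z))
  = 2%:R * ((-1) ^+ k * circ_eigen n (chi g ^+ 2) quad_circ k).
Proof.
have w_prim := generator_prim_root chi_gen.
set w := chi g in w_prim *.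
(* As g^n = -1, shifting j by n turns 1 - g^j into 1 + g^j; the factor v^n becomes (-1)^k. *)
have shift (v : algC) : v ^+ (2 * n) = 1 ->
    \sum_(0 <= j < 2 * n) (quad_char (1 - g ^+ j))%:~R * v ^+ j
      = v ^+ n * \sum_(0 <= j < 2 * n) (quad_char (1 + g ^+ j))%:~R * v ^+ j.
  move=> v_order; pose h j : algC := (quad_char (1 - g ^+ j))%:~R * v ^+ j.
  rewrite -(@sum_periodic_shift _ _ h n); last first.
    by move=> a; rewrite /h ![_ ^+ (a + _)]exprD gen_double v_order !mulr1.
  rewrite mulr_sumr; apply: eq_bigr => j _; rewrite /h ![_ ^+ (j + _)]exprD.
  by rewrite gen_half mulrN1 opprK mulrA mulrC mulrA.
have wn : w ^+ n = -1 := prim_root_half n_gt0 w_prim.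
have wk_order : (w ^+ k) ^+ (2 * n) = 1.
  by rewrite -exprM mulnC exprM (prim_expr_order w_prim) expr1n.
have wk_half : (w ^+ k) ^+ n = (-1) ^+ k by rewrite -exprM mulnC exprM wn.
have wkV_half : (w ^+ k)^-1 ^+ n = (-1) ^+ k by rewrite exprVn wk_half invr_sign.
have wkV_order : (w ^+ k)^-1 ^+ (2 * n) = 1 by rewrite exprVn wk_order invr1.
have wk_neq0 : w ^+ k != 0.
  by apply/eqP => wk0; move/eqP: wk_half; rewrite wk0 expr0n eqn0Ngt n_gt0 /= eq_sym signr_eq0.
rewrite !jacobi_sum_gen -/w -exprnN -exprnP !shift // wk_half wkV_half.
rewrite -mulrDr mulrCA; congr (_ * _).
pose h j : algC := (quad_char (1 + g ^+ j))%:~R * (w ^+ k)^-1 ^+ j.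
rewrite -[X in _ + X](@sum_periodic_opp _ _ h); last first.
  by move=> a; rewrite /h ![_ ^+ (a + _)]exprD gen_double wkV_order !mulr1.
rewrite -big_split /=.
rewrite (eq_big_nat _ _ (F2 := fun j =>
   (1 + (-1) ^+ j) * ((quad_char (1 + g ^+ j))%:~R * (w ^+ k) ^+ j))); last first.
  move=> j /andP[_ j_lt]; rewrite mulrDl mul1r; congr (_ + _); rewrite /h.
  have -> : (w ^+ k)^-1 ^+ (2 * n - j) = (w ^+ k) ^+ j.
    by rewrite exprVn expfB_cond ?(negPf wk_neq0) ?wk_order ?mul1r ?invrK // ltnW.
  rewrite mulrA; congr (_ * _); rewrite -[in RHS](rmorph_sign (intr : int -> algC)).
  rewrite -rmorphM /=; congr (_%:~R).
  have -> : 1 + g ^+ (2 * n - j) = g ^+ (2 * n - j) * (1 + g ^+ j).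
    by rewrite mulrDr mulr1 -exprD subnK ?gen_double 1?addrC // ltnW.
  rewrite quad_charM quad_char_gen; congr (_ * _).
  by rewrite -signr_odd oddB ?(ltnW j_lt) // oddM signr_odd.
rewrite sum_odd_even [X in _ + X]big1 ?addr0; last first.
  by move=> a _; rewrite exprS exprM sqrrN !expr1n mulr1 subrr mul0r.
rewrite mulr_sumr; apply: eq_bigr => a _.
rewrite exprM sqrrN !expr1n; congr (_ * _); rewrite [RHS]mulrC; congr (_ * _).
by rewrite -!exprM; congr (_ ^+ _); ring.
Qed.

(** The weight phi(x) + 1 is 2 on nonzero squares, 1 at 0 and 0 elsewhere. Summed against phi(x + 1)
    it gives 1 + 2S, with S the sum sought, and also -1 by [sum_quad_char_shift]. *)
Lemma sum_quad_circ : \sum_(0 <= c < n) quad_circ c = -1.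
Proof.
have shift1 := sum_quad_char_shift (oner_neq0 F).
have sum0 := sum_quad_char; rewrite (reindex (fun x => x + 1)) /= in sum0; last first.
  by exists (fun x => x - 1) => x _; rewrite ?addrK ?subrK.
have : \sum_(x : F) (quad_char x + 1) * quad_char (x + 1) = -1.
  under eq_bigr do rewrite mulrDl mul1r.
  by rewrite big_split /= shift1 sum0.
rewrite (bigD1 0) //= quad_char0 add0r mul1r add0r quad_char1 sum_gen sum_odd_even.
rewrite [X in _ + (_ + X)]big1 ?addr0; last first.
  by move=> a _; rewrite quad_char_gen exprS exprM sqrrN !expr1n mulr1 addNr mul0r.
rewrite (eq_bigr (fun a => 2%:Z * quad_circ a)) => [|a _]; last first.
  by rewrite quad_char_gen_double /quad_circ [1 + g ^+ _]addrC.
rewrite -mulr_sumr; set S := (\sum_(0 <= c < n) _ : int); lia.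
Qed.

(** At x = g^j, phi(x^3 + x) = phi(x) phi(1 + x^2) is (-1)^j times [quad_circ j]. For even n this
    has period n, and j runs over two periods. *)
Lemma a_E_circ : ~~ odd n -> a_E F = - (2%:Z * \sum_(0 <= c < n) (-1) ^+ c * quad_circ c).
Proof.
move=> n_even; rewrite /a_E; congr (- _).
rewrite (bigD1 0) //= expr0n addr0 quad_char0 add0r sum_gen.
pose h c := (-1) ^+ c * quad_circ c.
have -> : \sum_(0 <= j < 2 * n) quad_char ((g ^+ j) ^+ 3 + g ^+ j)
    = \sum_(0 <= j < 2 * n) h j.
  apply: eq_bigr => j _; rewrite /h -quad_char_gen -quad_charM; congr quad_char.
  by rewrite -!exprM mulrDr mulr1 -exprD addrC; congr (_ + _ ^+ _); lia.
rewrite (@big_cat_nat _ _ _ n) //=; last by lia.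
rewrite -{2}[n]add0n big_addn.
have -> : (2 * n - n = n)%N by lia.
rewrite (eq_bigr h (r := index_iota 0 n) (F1 := fun j => h (j + n)%N)) => [|j _].
  by rewrite -/h; ring.
by rewrite /h quad_circ_per exprD -(signr_odd _ n) (negPf n_even) expr0 mulr1.
Qed.

(** Factoring the square g^(2b) out of g^(2a) + g^(2b) leaves 1 + g^(2(a - b)). Rows and columns
    undergo the same permutation, so the signs cancel. *)
Lemma det_A_circ (s : 'I_n -> F) : enumerates_nonzero_squares s ->
  \det (A_ s) = \det (\matrix_(a < n, b < n) quad_circ (a + (n - b))).
Proof.
case=> s_inj s_sq.
have s_gen i : exists j : 'I_n, s i = g ^+ (2 * j).
  have /andP[si_neq0] := (s_sq (s i)).1 (ex_intro _ i erefl).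
  have [j j_lt ->] := gen_expr si_neq0; rewrite is_square_gen => j_even.
  have j2_lt : (j./2 < n)%N by lia.
  by exists (Ordinal j2_lt) => /=; rewrite mul2n halfK (negPf j_even) subn0.
have [t tE] := fin_all_exists s_gen.
have t_inj : injective t by move=> i j tij; apply: s_inj; rewrite !tE tij.
set M := (X in _ = \det X).
have -> : A_ s = row_perm (perm t_inj) (col_perm (perm t_inj) M).
  apply/matrixP => i j; rewrite !mxE !permE !tE /quad_circ.
  have -> : 1 + g ^+ (2 * (t i + (n - t j)))
      = g ^+ (2 * (n - t j)) * (g ^+ (2 * t i) + g ^+ (2 * t j)).
    rewrite mulrDr -!exprD -!mulnDr subnK ?gen_double; last by rewrite ltnW.
    by rewrite addrC addnC.
  by rewrite quad_charM quad_char_gen_double mul1r.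
rewrite row_permE col_permE !det_mulmx !det_perm odd_permV.
by rewrite mulrCA -signr_addb addbb mulr1.
Qed.

Lemma sum_quad_char_pair (u v : F) :
  \sum_x quad_char (u + x) * quad_char (v + x) = if u == v then (2 * n)%:Z else -1.
Proof.
rewrite (reindex (fun x => x - u)) /=; last first.
  by exists (fun x => x + u) => x _; rewrite ?addrK ?subrK.
case: eqVneq => [-> | uv_neq]; last first.
  rewrite -(@sum_quad_char_shift (v - u)) ?subr_eq0 1?eq_sym //.
  apply: eq_bigr => x _; rewrite addrC subrK; congr (_ * quad_char _); ring.
rewrite (bigD1 0) //= sub0r subrr quad_char0 mul0r add0r sum_gen.
rewrite (eq_bigr (fun=> 1)) => [|j _]; last first.
  by rewrite addrC subrK quad_charMself // gen_neq0.
by rewrite sumr_const_nat subn0 natz.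
Qed.

(** * Jacobsthal sums and a representation of q as a sum of two squares *)

Section TwoSquares.

Hypothesis n_even : ~~ odd n.

(** Half the Jacobsthal sum of phi(x) phi(x^2 + r) for r = g^b. *)
Let W (b : nat) : int := \sum_(0 <= j < n) (-1) ^+ j * quad_char (g ^+ (2 * j) + g ^+ b).

Lemma signrDn (j : nat) : (-1) ^+ (j + n) = (-1) ^+ j :> int.
Proof. by rewrite exprD -(signr_odd _ n) (negPf n_even) mulr1. Qed.

(** Shifting j by 1 releases the square factor g^2 and one sign. Hence the square of [W b] depends
    only on the parity of b. *)
Lemma jacobsthal_double (b : nat) : W b.+2 = - W b.
Proof.
pose h j : int := (-1) ^+ j * quad_char (g ^+ (2 * j) + g ^+ b.+2).
rewrite /W -(@sum_periodic_shift _ _ h 1); last first.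
  by move=> a; rewrite /h signrDn mulnDr [in g ^+ _]exprD gen_double mulr1.
rewrite -sumrN; apply: eq_bigr => j _; rewrite /h.
have -> : g ^+ (2 * (j + 1)) + g ^+ b.+2 = g ^+ 2 * (g ^+ (2 * j) + g ^+ b).
  by rewrite mulrDr -!exprD mulnDr; congr (_ + _); congr (_ ^+ _); lia.
by rewrite quad_charM quad_char_gen sqrrN expr1n mul1r addn1 [(-1) ^+ j.+1]exprS mulN1r mulNr.
Qed.

Lemma jacobsthal_sqr (b a : nat) : W (2 * a + b) ^+ 2 = W b ^+ 2.
Proof.
elim: a => [//|a IHa]; rewrite -IHa mulnS -addnA [(2 + _)%N]/= add2n jacobsthal_double.
by rewrite sqrrN.
Qed.

(* Sum [W b ^+ 2] over all b: by [sum_quad_char_pair] only the diagonal terms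
   survive. *)
Lemma jacobsthal_two_squares : W 0 ^+ 2 + W 1 ^+ 2 = (2 * n + 1)%:Z.
Proof.
have sum_sqr : \sum_(0 <= b < 2 * n) W b ^+ 2 = n%:Z * (W 0 ^+ 2 + W 1 ^+ 2).
  rewrite sum_odd_even -big_split /= (eq_bigr (fun=> W 0 ^+ 2 + W 1 ^+ 2)).
    by rewrite sumr_const_nat subn0 -mulr_natl natz.
  move=> a _; have := jacobsthal_sqr 0 a; have := jacobsthal_sqr 1 a.
  by rewrite addn0 addn1 => -> ->.
(* Makes the constant -2 in [inner] contribute nothing. *)
have sum_sign : \sum_(0 <= j < n) (-1) ^+ j = 0 :> int.
  have -> : n = (2 * n./2)%N by lia.
  rewrite sum_odd_even -big_split big1 //= => a _.
  by rewrite exprS mulN1r subrr.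
(* Removing the term x = 0, equal to 1, from [sum_quad_char_pair] turns its values 2n and -1 into 2n
   - 1 and -2. *)
have inner j l : (j < n)%N -> (l < n)%N ->
    \sum_(0 <= b < 2 * n) quad_char (g ^+ (2 * j) + g ^+ b) * quad_char (g ^+ (2 * l) + g ^+ b)
      = (if j == l then (2 * n + 1)%:Z else 0) - 2%:Z.
  move=> j_lt l_lt; have := sum_quad_char_pair (g ^+ (2 * j)) (g ^+ (2 * l)).
  rewrite (bigD1 0) //= !addr0 sum_gen.
  rewrite (eq_prim_root_expr g_prim) !modn_small; [|lia..].
  rewrite !quad_char_gen_double mulr1 eqn_mul2l /= => /(canRL (addKr 1)) ->.
  by case: eqP => _; lia.
have : \sum_(0 <= b < 2 * n) W b ^+ 2 = n%:Z * (2 * n + 1)%:Z.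
  transitivity (\sum_(0 <= j < n) \sum_(0 <= l < n) (-1) ^+ j * (-1) ^+ l *
      ((if j == l then (2 * n + 1)%:Z else 0) - 2%:Z)).
    rewrite (eq_bigr (fun b => \sum_(0 <= j < n) \sum_(0 <= l < n) (-1) ^+ j * (-1) ^+ l *
      (quad_char (g ^+ (2 * j) + g ^+ b) * quad_char (g ^+ (2 * l) + g ^+ b)))); last first.
      move=> b _; rewrite expr2 big_distrl /=; apply: eq_bigr => j _.
      by rewrite big_distrr /=; apply: eq_bigr => l _; rewrite mulrACA.
    rewrite exchange_big_nat /= !big_nat; apply: eq_bigr => j j_lt.
    rewrite exchange_big_nat /= !big_nat; apply: eq_bigr => l l_lt.
    by rewrite -mulr_sumr inner.
  transitivity (\sum_(0 <= j < n)
      ((2 * n + 1)%:Z - 2%:Z * (-1) ^+ j * \sum_(0 <= l < n) (-1) ^+ l)).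
    rewrite [LHS]big_nat [RHS]big_nat; apply: eq_bigr => j j_lt.
    rewrite (eq_bigr (fun l => (if j == l then (2 * n + 1)%:Z else 0)
        - 2%:Z * (-1) ^+ j * (-1) ^+ l)) => [|l _]; last first.
      by case: eqP => [<- | _]; [rewrite -expr2 sqrr_sign -mulrA -expr2 sqrr_sign|]; ring.
    rewrite sumrB -mulr_sumr; congr (_ - _).
    rewrite (bigD1_seq j) ?mem_index_iota ?iota_uniq //= eqxx big1 ?addr0 // => l.
    by rewrite eq_sym => /negPf ->.
  rewrite (eq_bigr (fun=> (2 * n + 1)%:Z)) => [|j _]; last by rewrite sum_sign mulr0 subr0.
  by rewrite sumr_const_nat subn0 -mulr_natl natz.
by rewrite sum_sqr; apply: mulfI; lia.
Qed.

(** By [a_E_circ], [- T] is half of a_q(E). *)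
Let T : int := \sum_(0 <= c < n) (-1) ^+ c * quad_circ c.

Lemma jacobsthal_sum_two_squares : exists v : int, T ^+ 2 + v ^+ 2 = (2 * n + 1)%:Z.
Proof.
exists (W 1); rewrite -jacobsthal_two_squares; congr (_ ^+ 2 + _).
by apply: eq_bigr => c _; rewrite /quad_circ expr0 addrC.
Qed.

Lemma quad_char_odd (x : F) : x != 0 -> (2%:Z %| quad_char x - 1)%Z.
Proof. by case/gen_expr=> j _ ->; rewrite quad_char_gen -signr_odd; case: odd. Qed.

(* With i = g ^+ (n / 2) a square root of -1, (1 + i) ^+ 2 = 2 * i. *)
Lemma quad_char_two : quad_char (2%:R : F) = (-1) ^+ (n %/ 2)%N.
Proof.
have i_sqr : (g ^+ (n %/ 2)%N) ^+ 2 = -1.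
  by rewrite -exprM -gen_half; congr (_ ^+ _); lia.
rewrite -quad_char_gen; set i := g ^+ _ in i_sqr *.
have two_neq0 : (2%:R : F) != 0.
  apply/eqP => two0; have := gen_half; rewrite -[-1]addr0 -two0.
  have -> : -1 + 2%:R = 1 :> F by ring.
  by move/eqP; rewrite -(prim_order_dvd g_prim) => /dvdn_leq; lia.
have i_neq0 : i != 0 := gen_neq0 _.
have sqr_eq : (1 + i) ^+ 2 = 2%:R * i by rewrite sqrrD i_sqr; ring.
have i1_neq0 : 1 + i != 0.
  apply/eqP => i1; move/eqP: sqr_eq.
  by rewrite i1 expr0n eq_sym mulf_eq0 (negPf two_neq0) (negPf i_neq0).
have := congr1 (@quad_char F) sqr_eq; rewrite expr2 !quad_charM quad_charMself // => eq1.
by rewrite -[LHS]mulr1 -(quad_charMself i_neq0) mulrA -eq1 mul1r.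
Qed.

(** Pairing c with n - c gives T = phi(2) + 2P: c = 0 contributes phi(2) = (-1)^(n/2) and c = n/2
    contributes phi(0) = 0. P has n/2 - 1 terms, all odd, hence the parity of n/2 - 1, so T is -1
    mod 4. *)
Lemma jacobsthal_sum_mod4 : (- T = 1 %[mod 4])%Z.
Proof.
pose h (c : nat) : int := (-1) ^+ c * quad_circ c.
pose P : int := \sum_(1 <= c < (n %/ 2)%N) h c.
have hsym c : (0 < c < n)%N -> h (n - c)%N = h c.
  move=> c_lt; rewrite /h quad_circ_even; last by lia.
  by congr (_ * _); rewrite -signr_odd oddB ?(negPf n_even) ?signr_odd //; lia.
have TE : T = (-1) ^+ (n %/ 2)%N + 2%:Z * P.
  rewrite /T big_ltn // -/(h 0%N) (big_palindrome _ hsym).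
  have -> : ((n - 1) %/ 2).+1 = (n %/ 2)%N by lia.
  have -> : (if odd n then 0 else if n is 0 then 0 else h (n %/ 2)%N) = 0.
    rewrite (negPf n_even); case En: n => [//|n']; rewrite -En /h /quad_circ.
    have -> : (2 * (n %/ 2) = n)%N by lia.
    by rewrite gen_half subrr quad_char0 mulr0.
  rewrite -/P /h /quad_circ expr0 muln0 expr0 mul1r -quad_char_two.
  have -> : 1 + 1 = 2%:R :> F by [].
  by rewrite /= addr0; ring.
have P_par : (2%:Z %| P - (n %/ 2 - 1)%:Z)%Z.
  have -> : P - (n %/ 2 - 1)%:Z = \sum_(1 <= c < (n %/ 2)%N) (h c - 1).
    by rewrite sumrB sumr_const_nat natz.
  rewrite big_nat; apply: rpred_sum => c c_lt.
  (* A vanishing 1 + g^(2c) would mean 2c = n, excluded by c < n/2. *)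
  have f_odd : (2%:Z %| quad_circ c - 1)%Z.
    apply: quad_char_odd; apply/eqP => /eqP; rewrite addrC addr_eq0 -gen_half.
    by rewrite (eq_prim_root_expr g_prim) !modn_small; lia.
  case/dvdzP: f_odd => r r_eq; apply/dvdzP; rewrite /h -signr_odd; case: (odd c).
    by exists (- r - 1); rewrite expr1; lia.
  by exists r; rewrite expr0; lia.
have [r r_eq] := dvdzP P_par.
apply/eqP; rewrite eqz_mod_dvd; apply/dvdzP.
rewrite TE (_ : P = r * 2 + (n %/ 2 - 1)%:Z); last by lia.
rewrite -signr_odd; case h_odd: (odd (n %/ 2)).
  by exists (- r - ((n %/ 2)./2)%:Z); rewrite expr1; lia.
by exists (- r - ((n %/ 2)./2)%:Z); rewrite expr0; lia.
Qed.

End TwoSquares.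

(** * [x_] and the determinant of [A_] as products of eigenvalues *)

Lemma R_prod :
  R_ chi = \prod_(1 <= k < ((n - 1) %/ 2).+1)
    (2%:R * ((-1) ^+ k * circ_eigen n (chi g ^+ 2) quad_circ k)).
Proof.
rewrite (@big_nat_widenl _ _ _ 1 0) // (@big_nat_widen _ _ _ 0 _ #|F|); last by lia.
rewrite big_mkord; apply: eq_big => k; first by have := cardF; lia.
by move=> _; apply: jacobi_sum_circ.
Qed.

(** Each factor in [R_prod] carries one 2, and together these cancel the denominator. *)
Lemma x_prod : x_ n chi = (-1) ^+ (\sum_(1 <= k < ((n - 1) %/ 2).+1) k)
  * \prod_(1 <= k < ((n - 1) %/ 2).+1) circ_eigen n (chi g ^+ 2) quad_circ k.
Proof.
rewrite /x_ R_prod big_split /= prodr_const_nat subn1 /= mulrC mulKf; last first.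
  by rewrite expf_neq0 // pnatr_eq0.
by rewrite big_split /= prodrXr.
Qed.

Lemma sqr_char_prim_root : n.-primitive_root (chi g ^+ 2).
Proof.
have := dvdn_prim_root (generator_prim_root chi_gen) (dvdn_mull 2 (dvdnn n)).
by rewrite mulnK.
Qed.

Lemma x_int : x_ n chi \is a Num.int.
Proof.
rewrite x_prod -(det_circulant_odd n_gt0 sqr_char_prim_root quad_circ_per quad_circ_even).
by rewrite rpredM ?rpredX ?rpredN1 ?intr_int.
Qed.

Lemma circ_eigen0 : circ_eigen n (chi g ^+ 2) quad_circ 0 = -1.
Proof.
rewrite /circ_eigen -[RHS](rmorphN1 (intr : int -> algC)) -sum_quad_circ rmorph_sum.
by apply: eq_bigr => c _; rewrite mul0n mul1r.
Qed.

(** The root z = chi(g)^2 satisfies z^(n/2) = chi(g)^n = -1. *)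
Lemma circ_eigen_half : ~~ odd n ->
  circ_eigen n (chi g ^+ 2) quad_circ (n %/ 2)
    = (\sum_(0 <= c < n) (-1) ^+ c * quad_circ c)%:~R.
Proof.
move=> n_even; rewrite /circ_eigen rmorph_sum; apply: eq_bigr => c _.
rewrite rmorphM rmorph_sign; congr (_ * _).
rewrite exprM -[(chi g ^+ 2) ^+ (n %/ 2)]exprM; have -> : (2 * (n %/ 2) = n)%N by lia.
by rewrite (prim_root_half n_gt0 (generator_prim_root chi_gen)).
Qed.

(** The eigenvalue at 0 supplies the minus sign. Those at k and n - k coincide and build the square,
    in which the sign from [x_prod] disappears; the one at n/2 is left over for even n. *)
Lemma det_A_prod (s : 'I_n -> F) : enumerates_nonzero_squares s ->
  (\det (A_ s))%:~R = - (x_ n chi ^+ 2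
    * (if odd n then 1 else circ_eigen n (chi g ^+ 2) quad_circ (n %/ 2))).
Proof.
move=> s_sq; rewrite det_A_circ //.
rewrite (det_circulant n_gt0 sqr_char_prim_root quad_circ_per) big_ltn //.
rewrite circ_eigen0 mulN1r (@big_palindrome _ _ _ n); last first.
  move=> k k_lt; apply: (circ_eigen_sym n_gt0 sqr_char_prim_root quad_circ_per quad_circ_even).
  by lia.
rewrite x_prod exprMn sqrr_sign mul1r expr2; congr (- (_ * _)).
by case: n n_gt0.
Qed.

End QuadraticCharacter.

(** Composing the two representations gives p^2 = X^2 + Y^2 with X = ac + 2bd and Y = 2ad - bc. Once
    p divides Y, either X = 0, which makes a even, or Y = 0, which gives a = c or a = -c; residues
    mod 4 decide. *)
Lemma two_squares_unique (p : nat) (a b c d : int) : prime p ->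
  p%:Z = a ^+ 2 + b ^+ 2 -> p%:Z = c ^+ 2 + 4 * d ^+ 2 ->
  (a = 1 %[mod 4])%Z -> (c = 1 %[mod 4])%Z -> a = c.
Proof.
move=> p_prime ab cd a_mod c_mod.
have p_gt0 : 0 < p%:Z by rewrite ltz_nat prime_gt0.
(* p divides (2ad - bc)(2ad + bc), and replacing b by -b exchanges the factors up to order. *)
wlog p_dvd : b ab / (p %| 2 * a * d - b * c)%Z.
  move=> wlog_dvd.
  have : (p %| (2 * a * d - b * c) * (2 * a * d + b * c))%Z.
    apply/dvdzP; exists (4 * d ^+ 2 - b ^+ 2).
    have -> : (4 * d ^+ 2 - b ^+ 2) * p%:Z = 4 * d ^+ 2 * p%:Z - b ^+ 2 * p%:Z by ring.
    by rewrite {1}ab cd; ring.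
  rewrite dvdzE abszM Euclid_dvdM // => /orP[] p_dvd.
    exact: (wlog_dvd b).
  by apply: (wlog_dvd (- b)); rewrite ?sqrrN // mulNr opprK.
have sqr_eq : p%:Z ^+ 2 = (a * c + 2 * b * d) ^+ 2 + (2 * a * d - b * c) ^+ 2.
  by rewrite expr2 {1}ab cd; ring.
have [r r_eq] := dvdzP p_dvd.
(* Recovers a from X and Y through p = c^2 + 4d^2. *)
have aE : a * p%:Z = c * (a * c + 2 * b * d) + 2 * d * (2 * a * d - b * c).
  by rewrite cd; ring.
rewrite r_eq in sqr_eq aE; set X := a * c + 2 * b * d in sqr_eq aE.
have p_neq0 : p%:Z != 0 by rewrite gt_eqF.
have [X0 | X_neq0] := eqVneq X 0.
  have a_even : a = 2 * (d * r).
    by apply: (mulIf p_neq0); rewrite aE X0; ring.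
  by move: a_mod; rewrite a_even; lia.
(* With X nonzero, a nonzero multiple of p as Y would make X^2 + Y^2 exceed p^2. *)
have r0 : r = 0.
  apply/eqP; apply: contraT => r_neq0.
  have r_ge1 : 1 <= r ^+ 2 by rewrite -gtz0_ge1 exprn_even_gt0.
  have X_gt0 : 0 < X ^+ 2 by rewrite exprn_even_gt0.
  have : p%:Z ^+ 2 <= (r * p%:Z) ^+ 2 by rewrite exprMn ler_peMl // sqr_ge0.
  by rewrite sqr_eq gerDr leNgt X_gt0.
rewrite r0 mul0r mulr0 addr0 in aE; rewrite r0 mul0r expr0n addr0 in sqr_eq.
move/eqP: sqr_eq; rewrite eqf_sqr => /orP[] /eqP pX.
  by apply: (mulIf p_neq0); rewrite aE pX.
have a_opp : a = - c by apply: (mulIf p_neq0); rewrite aE pX; ring.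
by move: a_mod; rewrite a_opp; lia.
Qed.

(** * Integrality and the congruence cases, read off from the eigenvalue formula *)

Unset Implicit Arguments.

Theorem theorem1p2 (F : finFieldType) (n : nat) (hq : #|F| = (2 * n + 1)%N)
    (chi : F -> algC) (hchi : mult_char_generator chi)
    (s : 'I_n -> F) (hs : enumerates_nonzero_squares s) :
  [/\ x_ n chi \is a Num.int,
      #|F| = 3 %[mod 4] ->
        - (\det (A_ s))%:~R = x_ n chi ^+ 2,
      #|F| = 1 %[mod 4] ->
        2%:R * (\det (A_ s))%:~R = (a_E F)%:~R * x_ n chi ^+ 2
    & #|F| = 1 %[mod 4] -> prime #|F| ->
        forall c d : int,
          (#|F|)%:Z = c ^+ 2 + 4 * d ^+ 2 -> (c = 1 %[mod 4])%Z ->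
          (\det (A_ s))%:~R / c%:~R = x_ n chi ^+ 2].
Proof.
have n_gt0 : (0 < n)%N by have := finNzRing_gt1 F; rewrite hq; lia.
have [g] := finField_prim_root F; rewrite [in X in X -> _]hq addn1 /= => g_prim.
have detE := det_A_prod n_gt0 hq g_prim hchi hs.
split.
- exact: (x_int n_gt0 hq g_prim hchi).
- move=> F_mod; have n_odd : odd n by move: F_mod; rewrite hq; lia.
  by rewrite detE n_odd mulr1 opprK.
- move=> F_mod; have n_even : ~~ odd n by move: F_mod; rewrite hq; lia.
  rewrite detE (negPf n_even) (circ_eigen_half n_gt0 hq g_prim hchi n_even).
  rewrite (a_E_circ n_gt0 hq g_prim n_even) rmorphN rmorphM /=; ring.
move=> F_mod F_prime c d F_eq c_mod; have n_even : ~~ odd n by move: F_mod; rewrite hq; lia.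
rewrite detE (negPf n_even) (circ_eigen_half n_gt0 hq g_prim hchi n_even).
have [v T_eq] := jacobsthal_sum_two_squares n_gt0 hq g_prim n_even.
have T_mod := jacobsthal_sum_mod4 n_gt0 hq g_prim n_even.
set T := (\sum_(0 <= _ < n) _) in T_eq T_mod *.
(* Both [- T] and [c] are 1 mod 4 and occur in representations of p as a sum of two squares, so
   uniqueness identifies them. *)
have <- : - T = c.
  by apply: (two_squares_unique F_prime (b := v) _ F_eq T_mod c_mod); rewrite sqrrN T_eq hq.
(* The value 0 would contradict [- T] being 1 mod 4. *)
have T_neq0 : (- T)%:~R != 0 :> algC.
  by rewrite intr_eq0; apply/eqP => T0; rewrite T0 in T_mod.
by rewrite -mulrN -rmorphN mulfK.
Qed.
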